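(* For $n\ge 0$ and $k\ge 0$, the number $v_{n,k}$ of tilings of the honeycomb strip $H_n$ by monomers, slanted dimers and trimers using exactly $k$ monomers is $$v_{n,k}=\sum_{\substack{i_0,\dots,i_k> 0\\ i_0+\cdots+i_k=n+2k+3}}P_{i_0}P_{i_1}\cdots P_{i_k},$$ where $P_j$ is the Padovan sequence: $P_0=1$, $P_1=P_2=0$ and $P_j=P_{j-2}+P_{j-3}$ for $j\ge 3$.
   Context: The honeycomb strip $H_n$ consists of $n$ regular hexagons numbered $1,\dots,n$ arranged in two rows (odd-numbered on the bottom, even-numbered on top), hexagon $i$ sharing an edge with hexagons $i\pm1$ and $i\pm2$. The allowed tiles are: monomers $\{i\}$, slanted dimers $\{i,i+1\}$, and trimers $\{i,i+1,i+2\}$ (horizontal dimers $\{i,i+2\}$ are not allowed); a tiling is a partition of the hexagons of $H_n$ into such tiles, and $H_0$ has one (empty) tiling. *)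

(* Defs.v *)
From mathcomp Require Import all_boot.

Set Implicit Arguments.
Unset Strict Implicit.
Unset Printing Implicit Defensive.

(* Hexagon number h of the strip H_n (1 <= h <= n) is the ordinal of 'I_n of  *)
(* value h - 1.                                                               *)

Definition is_monomer (n : nat) (B : {set 'I_n}) : bool :=
  [exists i : 'I_n, B == [set i]].

Definition is_slanted_dimer (n : nat) (B : {set 'I_n}) : bool :=
  [exists i : 'I_n, exists j : 'I_n,
     (val j == (val i).+1) && (B == [set i; j])].

Definition is_trimer (n : nat) (B : {set 'I_n}) : bool :=
  [exists i : 'I_n, exists j : 'I_n, exists l : 'I_n,
     [&& val j == (val i).+1, val l == (val i).+2 & B == [set i; j; l]]].

Definition is_tile (n : nat) (B : {set 'I_n}) : bool :=
  [|| is_monomer B, is_slanted_dimer B | is_trimer B].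

Definition is_tiling (n : nat) (T : {set {set 'I_n}}) : bool :=
  partition T [set: 'I_n] && [forall B in T, is_tile B].

Definition nb_monomers (n : nat) (T : {set {set 'I_n}}) : nat :=
  #|[set B in T | is_monomer B]|.

Definition nb_tilings (n k : nat) : nat :=
  #|[set T : {set {set 'I_n}} | is_tiling T & nb_monomers T == k]|.

Fixpoint padovan (j : nat) : nat :=
  match j with
  | 0 => 1
  | 1 => 0
  | 2 => 0
  | ((j3.+1) as j2).+2 => padovan j2 + padovan j3
  end.

(* Main.v *)
Require Import Defs.
From mathcomp Require Import all_boot all_algebra zify.

Set Implicit Arguments.
Unset Strict Implicit.
Unset Printing Implicit Defensive.

Import GRing.Theory.

(** Removing the tile that contains the last hexagon gives
      v(n, k) = v(n-1, k-1) + v(n-2, k) + v(n-3, k).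
    In terms of W(x) = \sum_i P_(i+3) x^i, which satisfies
    W = 1 + (x^2 + x^3) W, the same recurrence holds for the coefficients of
    x^k W^(k+1), and expanding (x^3 W)^(k+1) = (\sum_(i > 0) P_i x^i)^(k+1)
    gives the sum over compositions. All tilings are taken inside one fixed
    strip, so that tiles need not be transported between ordinal types, and
    W is truncated to a polynomial. *)

(** * Set partitions sorted by the block of a point *)

Lemma partitionD_notin (T : finType) (P : {set {set T}}) (D B : {set T}) x :
  partition P (D :\: B) -> x \in B -> B \notin P.
Proof.
move=> PD Bx; apply/negP => /(partitionS PD)/subsetP/(_ x Bx).
by rewrite inE Bx.
Qed.

(** Sort the partitions by the block [B] of [x]; deleting [B] is then a bijection onto the
    partitions of [D :\: B], with inverse [P |-> B |: P]. *)
Lemma card_partition_pblock (T : finType) (D : {set T}) (x : T)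
    (Q : pred {set {set T}}) : x \in D ->
  #|[set P | partition P D && Q P]| =
  \sum_(B : {set T} | (x \in B) && (B \subset D))
     #|[set P | partition P (D :\: B) && Q (B |: P)]|.
Proof.
move=> Dx; rewrite -sum1dep_card.
rewrite (partition_big (fun P => pblock P x)
          (fun B : {set T} => (x \in B) && (B \subset D))); last first.
  move=> P /andP[PD _]; rewrite mem_pblock (cover_partition PD) Dx /=.
  by apply: (partitionS PD); rewrite pblock_mem // (cover_partition PD).
apply: eq_bigr => B /andP[Bx BD]; rewrite sum1dep_card.
have Bn P (PD : partition P (D :\: B)) := partitionD_notin PD Bx.
rewrite -[RHS](@card_in_imset _ _ (fun P => B |: P)); last first.
  move=> P1 P2; rewrite !inE => /andP[/Bn n1 _] /andP[/Bn n2 _] eqP12.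
  by rewrite -(setU1K n1) eqP12 setU1K.
apply: eq_card => P; rewrite !inE; apply/idP/imsetP.
  case/andP=> /andP[PD QP] /eqP PxB.
  have BP : B \in P by rewrite -PxB pblock_mem // (cover_partition PD).
  by exists (P :\ B); rewrite ?inE ?setD1K // QP (partitionD1 PD).
case=> P'; rewrite inE => /andP[P'D QP' ->].
have PD : partition (B |: P') D.
  have -> : D = B :|: (D :\: B).
    apply/setP => y; rewrite !inE; case By: (y \in B) => //=.
    exact: (subsetP BD).
  apply: partitionU1 => //; first by apply/set0Pn; exists x.
  by rewrite -setI_eq0 setDE setICA setICr setI0.
rewrite PD QP' /=; apply/eqP; apply: def_pblock (partition_trivIset PD) _ Bx.
exact: setU11.
Qed.

(** * Tilings inside a fixed strip and their recurrence *)

Section Tilings.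
Variable N : nat.
Implicit Types (T : {set {set 'I_N}}) (B : {set 'I_N}).

Definition initial_strip m : {set 'I_N} := [set i : 'I_N | i < m].

Definition nb_tilings_of (D : {set 'I_N}) (k : nat) :=
  #|[set T | partition T D &
             [forall B in T, is_tile B] && (nb_monomers T == k)]|.

Lemma nb_monomersU1 B T : B \notin T ->
  nb_monomers (B |: T) = is_monomer B + nb_monomers T.
Proof.
move=> BT; rewrite /nb_monomers.
case mB: (is_monomer B).
  have -> : [set C in B |: T | is_monomer C] = B |: [set C in T | is_monomer C].
    by apply/setP => C; rewrite !inE; case: eqVneq => // ->; rewrite mB.
  by rewrite cardsU1 inE (negPf BT).
apply: eq_card => C; rewrite !inE.
by case: eqVneq => // ->; rewrite mB !andbF.
Qed.

Lemma forall_tileU1 B T :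
  [forall C in B |: T, is_tile C] = is_tile B && [forall C in T, is_tile C].
Proof.
apply/forall_inP/andP => [h|[hB /forall_inP hT] C].
  split; first by apply: h; rewrite setU11.
  by apply/forall_inP => C CT; apply: h; rewrite setU1r.
by case/setU1P => [->|/hT].
Qed.

(** The factor [is_monomer B <= k] guards the truncated subtraction: for [k = 0] a monomer must
    contribute nothing, although [0 - 1] is [0]. *)
Lemma nb_tilings_of_pblock (D : {set 'I_N}) x k : x \in D ->
  nb_tilings_of D k =
  \sum_(B : {set 'I_N} | [&& x \in B, B \subset D & is_tile B])
     (is_monomer B <= k) * nb_tilings_of (D :\: B) (k - is_monomer B).
Proof.
move=> Dx; rewrite /nb_tilings_of (card_partition_pblock _ Dx).
rewrite (bigID (@is_tile N)) /= [X in _ + X]big1 ?addn0; last first.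
  move=> B /andP[_ /negPf tB]; apply: eq_card0 => T.
  by rewrite !inE forall_tileU1 tB !andbF.
apply: eq_big => [B|B /andP[/andP[Bx BD] tB]]; first by rewrite andbA.
have [le_k|lt_k] := leqP; rewrite ?mul1n ?mul0n; last first.
  apply: eq_card0 => T; rewrite !inE; apply/negP => /and3P[TD _].
  rewrite nb_monomersU1 ?(gtn_eqF (leq_trans lt_k (leq_addr _ _))) //.
  exact: partitionD_notin TD Bx.
apply: eq_card => T; rewrite !inE.
case TD: (partition T (D :\: B)) => //=.
rewrite forall_tileU1 tB nb_monomersU1 ?(partitionD_notin TD Bx) //=.
by rewrite -(eqn_add2l (is_monomer B) (nb_monomers T)) subnKC.
Qed.

(* The s + 1 hexagons ending with the hexagon of index m. *)
Definition last_segment m s : {set 'I_N} :=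
  [set i : 'I_N | m <= i + s & i <= m].

Lemma is_monomer_segment m s : m < N -> s <= m ->
  is_monomer (last_segment m s) = (s == 0).
Proof.
move=> ltmN le_sm; apply/existsP/eqP => [[i /eqP/setP eqi]|->].
  (* The indices [m - s] and [m] both lie in the segment, so a singleton forces them to coincide. *)
  have ltsN : m - s < N by lia.
  have := eqi (Ordinal ltmN); have := eqi (Ordinal ltsN).
  rewrite !inE /= -!val_eqE /=; lia.
exists (Ordinal ltmN); apply/eqP/setP => j; rewrite !inE -val_eqE /=; lia.
Qed.

(** Every tile is a run of one, two or three consecutive indices. Since no index of [B] exceeds [m],
    the run must end at [m], and only its length is free. *)
Lemma last_tileP m (lt_mN : m < N) B :
  [&& Ordinal lt_mN \in B, B \subset initial_strip m.+1 & is_tile B] =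
  [exists s : 'I_3, (s <= m) && (B == last_segment m s)].
Proof.
apply/and3P/existsP => [[Bm /subsetP BD]|[s /andP[le_sm /eqP ->]]].
  have {}BD i : i \in B -> i <= m by move/BD; rewrite inE ltnS.
  case/or3P.
  - case/existsP=> i /eqP eB; move: Bm; rewrite eB inE => /eqP eqi.
    exists ord0; rewrite leq0n; apply/eqP/setP => j.
    by rewrite !inE -val_eqE -eqi /= addn0 eqn_leq andbC.
  - case/existsP=> i /existsP[j /andP[/eqP eij /eqP eB]].
    have: j <= m by apply: BD; rewrite eB !inE eqxx orbT.
    move: Bm; rewrite eB !inE -!val_eqE /= => hm hj; rewrite /= in eij.
    exists (inord 1); rewrite inordK //; apply/andP; split; first lia.
    apply/eqP/setP => l; rewrite !inE -!val_eqE /=; lia.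
  - case/existsP=> i /existsP[j /existsP[l /and3P[/eqP eij /eqP eil /eqP eB]]].
    have: l <= m by apply: BD; rewrite eB !inE eqxx !orbT.
    move: Bm; rewrite eB !inE -!val_eqE /= => hm hj; rewrite /= in eij eil.
    exists (inord 2); rewrite inordK //; apply/andP; split; first lia.
    apply/eqP/setP => a; rewrite !inE -!val_eqE /=; lia.
split; first by rewrite inE /=; lia.
  by apply/subsetP => i; rewrite !inE ltnS => /andP[].
case: s le_sm => -[|[|[|//]]] //= _ le_sm; apply/or3P.
- by constructor 1; rewrite is_monomer_segment.
- have lt1 : m - 1 < N by lia.
  constructor 2; apply/existsP; exists (Ordinal lt1).
  apply/existsP; exists (Ordinal lt_mN).
  apply/andP; split; first by rewrite /=; lia.
  apply/eqP/setP => i; rewrite !inE -!val_eqE /=; lia.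
- have lt1 : m - 1 < N by lia.
  have lt2 : m - 2 < N by lia.
  constructor 3; apply/existsP; exists (Ordinal lt2).
  apply/existsP; exists (Ordinal lt1); apply/existsP; exists (Ordinal lt_mN).
  apply/and3P; split; rewrite /=; try lia.
  apply/eqP/setP => i; rewrite !inE -!val_eqE /=; lia.
Qed.

(** The least index [m - s] determines [s]; for [s > m] the segments would be cut off at index 0 and
    coincide. *)
Lemma last_segment_inj m : m < N ->
  {in [pred s | s <= m] &, injective (last_segment m)}.
Proof.
move=> lt_mN s t; rewrite !inE => le_sm le_tm /setP eq_st.
have lt_s : m - s < N by lia.
have lt_t : m - t < N by lia.
have := eq_st (Ordinal lt_s); have := eq_st (Ordinal lt_t).
rewrite !inE /=; lia.
Qed.

Definition nb_strip_tilings m (k : nat) := nb_tilings_of (initial_strip m) k.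

Lemma nb_strip_tilings0 k : nb_strip_tilings 0 k = (k == 0).
Proof.
rewrite /nb_strip_tilings /nb_tilings_of.
have -> : initial_strip 0 = set0 by apply/setP => i; rewrite !inE.
have nb0 : nb_monomers (set0 : {set {set 'I_N}}) = 0.
  by apply: eq_card0 => B; rewrite !inE.
have [->|kn0] := eqVneq k 0.
  rewrite /= -(cards1 (set0 : {set {set 'I_N}})); apply: eq_card => T.
  rewrite !inE partition_set0; case: eqVneq => //= ->.
  by rewrite nb0 eqxx andbT; apply/forall_inP => B; rewrite inE.
apply: eq_card0 => T; rewrite !inE partition_set0; case: eqVneq => //= ->.
by rewrite nb0 eq_sym (negPf kn0) andbF.
Qed.

Lemma nb_strip_tilingsS m k : m < N ->
  nb_strip_tilings m.+1 k =
  \sum_(s < 3 | s <= m)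
     ((s == 0 :> nat) <= k) * nb_strip_tilings (m - s) (k - (s == 0 :> nat)).
Proof.
move=> lt_mN; rewrite /nb_strip_tilings.
rewrite (@nb_tilings_of_pblock _ (Ordinal lt_mN)); last by rewrite inE /=.
rewrite (eq_bigl _ _ (last_tileP lt_mN)).
rewrite (eq_bigl (mem [set last_segment m s | s : 'I_3 & s <= m])); last first.
  move=> B; apply/existsP/imsetP => [[s /andP[h /eqP ->]]|[s]].
    by exists s; rewrite ?inE.
  by rewrite inE => h ->; exists s; rewrite eqxx andbT.
rewrite big_imset /=; last first.
  move=> s t; rewrite !inE => hs ht /(last_segment_inj lt_mN) h; apply/val_inj.
  by apply: h; rewrite inE.
apply: eq_big => [s|s]; rewrite inE // => le_sm.
rewrite is_monomer_segment //; congr (_ * nb_tilings_of _ _).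
(* What remains after removing the last tile is again an initial strip, of length [m - s]. *)
apply/setP => i; rewrite !inE; lia.
Qed.

End Tilings.

Lemma nb_tilings_strip n k : nb_tilings n k = nb_strip_tilings n n k.
Proof.
have -> : nb_strip_tilings n n k = nb_tilings_of [set: 'I_n] k.
  by congr nb_tilings_of; apply/setP => i; rewrite !inE ltn_ord.
by apply: eq_card => T; rewrite !inE /is_tiling andbA.
Qed.

(** * Truncated generating functions *)

Local Open Scope ring_scope.

Definition padovan_poly L : {poly nat} := \poly_(i < L) padovan (i + 3).

Lemma coefM_eq (R : nzSemiRingType) (p q r : {poly R}) n :
  (forall j, (j <= n)%N -> p`_j = q`_j) -> (p * r)`_n = (q * r)`_n.
Proof.
move=> eq_pq; rewrite !coefM; apply: eq_bigr => j _.
by rewrite eq_pq // -ltnS.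
Qed.

Lemma coef_padovan_poly L n : (n < L)%N ->
  (padovan_poly L)`_n = (1 + ('X^2 + 'X^3) * padovan_poly L)`_n.
Proof.
move=> ltnL; rewrite mulrDl !coefD coef1 !coefXnM !coef_poly ltnL.
case: n ltnL => [|[|[|n]]] //= ltnL.
  by rewrite subnn (leq_ltn_trans _ ltnL).
rewrite !subSS !subn0 (ltnW (ltnW ltnL)) (ltnW (ltnW (ltnW ltnL))) add0r.
by rewrite !addn3.
Qed.

Definition tiling_poly L k : {poly nat} := 'X^k * padovan_poly L ^+ k.+1.

(** Apply the equation for W to a single factor of the power. It holds only below degree [L], which
    suffices because coefficient [n] of a product sees only coefficients up to [n] of that
    factor. *)
Lemma coef_tiling_poly L n k : (n < L)%N ->
  (tiling_poly L k)`_n =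
  ((if k is k'.+1 then 'X * tiling_poly L k' else 1)
    + ('X^2 + 'X^3) * tiling_poly L k)`_n.
Proof.
move=> ltnL; set p := padovan_poly L.
have -> : tiling_poly L k = p * ('X^k * p ^+ k).
  by rewrite /tiling_poly exprS mulrCA.
rewrite (@coefM_eq _ p (1 + ('X^2 + 'X^3) * p)); last first.
  by move=> j le_jn; apply: coef_padovan_poly; apply: leq_ltn_trans ltnL.
rewrite mulrDl mul1r -mulrA; congr (nth _ (polyseq (_ + _)) _).
by case: k => [|k]; rewrite ?mulr1 // /tiling_poly exprS mulrA.
Qed.

Lemma nb_strip_tilingsE N L m k : (m <= N)%N -> (m < L)%N ->
  nb_strip_tilings N m k = (tiling_poly L k)`_m.
Proof.
elim/ltn_ind: m k => -[|m] IH k le_mN lt_mL.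
  rewrite nb_strip_tilings0 coef_tiling_poly // mulrDl !coefD !coefXnM /=.
  by case: k => [|k]; rewrite ?coef1 ?coefXM.
rewrite nb_strip_tilingsS // big_mkcond !big_ord_recl big_ord0 /=.
rewrite coef_tiling_poly // mulrDl !coefD (coefXnM 2) (coefXnM 3) /bump /=.
rewrite !subSS !subn0 !mul1n !addn0 !ltnS !add1n.
(* The three summands match monomer, dimer and trimer; the conditions [s <= m] correspond to the low
   coefficients killed by ['X^2] and ['X^3]. *)
congr (_ + (_ + _)).
- case: k => [|k]; first by rewrite coef1.
  by rewrite coefXM /= mul1n subn1 IH //; lia.
- by case: ltnP => // m_gt0; rewrite IH //; lia.
- by case: ltnP => // m_gt1; rewrite IH //; lia.
Qed.

(** Distributing the power, [i] records the monomial chosen in each factor, and degree [M] selects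
    the choices of exponent sum [M]. *)
Lemma coef_exp_poly (a : nat -> nat) k M :
  (\sum_(i : {ffun 'I_k -> 'I_M.+1} | (\sum_j i j == M)%N) \prod_j a (i j))%N =
  ((\poly_(i < M.+1) a i) ^+ k)`_M.
Proof.
rewrite poly_def -[X in _ ^+ X]card_ord -prodr_const.
rewrite (bigA_distr_bigA (fun (_ : 'I_k) (i : 'I_M.+1) => a i *: 'X^i)).
rewrite coef_sum big_mkcond; apply: eq_bigr => i _.
rewrite scaler_prod coefZ -(big_morph _ (exprD 'X) (expr0 'X)) coefXn.
by rewrite eq_sym; case: eqP => _ /=; rewrite ?mulr1 ?mulr0.
Qed.

Local Close Scope ring_scope.

(* A (k+1)-tuple of positive integers of sum n + 2k + 3 has all its entries   *)
(* at most n + 2k + 3, hence the bound on the range of the index functions.   *)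
Theorem theorem11 (n k : nat) :
  nb_tilings n k =
  \sum_(i : {ffun 'I_k.+1 -> 'I_(n + 2 * k + 3).+1}
          | [forall j, 0 < i j] && (\sum_j i j == n + 2 * k + 3))
     \prod_j padovan (i j).
Proof.
set M := n + 2 * k + 3.
(* Replacing P_0 = 1 by 0 encodes positivity of the indices: a tuple with a zero entry contributes
   0. *)
pose a i := if i is 0 then 0 else padovan i.
transitivity (\sum_(i : {ffun 'I_k.+1 -> 'I_M.+1} | \sum_j i j == M)
                \prod_j a (i j)).
  (* The truncation [M.-2] is chosen so that multiplying by ['X^3] gives exactly the range
     [i < M.+1]. *)
  have ltnL : n < M.-2 by rewrite /M; lia.
  rewrite coef_exp_poly nb_tilings_strip (nb_strip_tilingsE k (leqnn n) ltnL).
  have -> : (\poly_(i < M.+1) a i = 'X^3 * padovan_poly M.-2)%R.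
    apply/polyP => i; rewrite coefXnM !coef_poly.
    case: i => [|[|[|i]]]; rewrite ?if_same //= addn3 subSS subSS subSS subn0.
    congr (if _ then _ else _); rewrite /M; lia.
  rewrite exprMn -exprM /tiling_poly !coefXnM.
  (* Both sides are coefficient [n - k] of W^(k+1), or 0 when [n < k], because M - 3(k+1) = n -
     k. *)
  have -> : (M < 3 * k.+1) = (n < k) by rewrite /M; lia.
  by have -> : M - 3 * k.+1 = n - k by rewrite /M; lia.
pose pos (i : {ffun 'I_k.+1 -> 'I_M.+1}) := [forall j, 0 < i j].
rewrite [LHS](bigID pos) /=.
rewrite [X in _ + X]big1 ?addn0; last first.
  move=> i /andP[_ /forallPn[j]]; rewrite -eqn0Ngt => /eqP ij0.
  by rewrite (bigD1 j) //= ij0.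
apply: eq_big => [i|i /andP[_ /forallP i_gt0]]; first by rewrite andbC.
by apply: eq_bigr => j _; have := i_gt0 j; case: (i j) => -[].
Qed.
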